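(* For every even $n\ge4$, no vertex of the unweighted cycle $C_n$ is sedentary.
   Context: For a graph with adjacency matrix $A$, $U(t)=e^{itA}$. A vertex $u$ is sedentary if $\inf_{t>0}|U(t)_{u,u}|\ge C$ for some constant $0<C\le1$, and not sedentary if $\inf_{t>0}|U(t)_{u,u}|=0$. *)

(* Defs.v *)
From mathcomp Require Import all_boot all_order all_algebra.
From mathcomp Require Import all_classical all_reals all_analysis.
From mathcomp Require Export complex.
Import Order.TTheory GRing.Theory Num.Theory numFieldNormedType.Exports.

Set Implicit Arguments.
Unset Strict Implicit.
Unset Printing Implicit Defensive.

Local Open Scope ring_scope.
Local Open Scope complex_scope.
Local Open Scope classical_set_scope.

Definition cycle_adj (R : realType) (n : nat) : 'M[R[i]]_n :=
  \matrix_(i < n, j < n) (((i.+1 %% n)%N == j) || ((j.+1 %% n)%N == i))%:R.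

(* k-th power of a square matrix (valid for every size n, including 0). *)
Definition mxpow (R : realType) (n : nat) (A : 'M[R[i]]_n) (k : nat) : 'M[R[i]]_n :=
  iter k (mulmx A) 1%:M.

Definition transU (R : realType) (n : nat) (A : 'M[R[i]]_n) (t : R) : 'M[R[i]]_n :=
  lim (series (fun k : nat => ((t%:C * 'i) ^+ k / (k`!)%:R) *: mxpow A k) @ \oo).

Definition not_sedentary (R : realType) (n : nat) (A : 'M[R[i]]_n) (u : 'I_n) : Prop :=
  inf [set Normc.normc (transU A t u u) | t in [set t : R | 0 < t]] = 0.

(* Main.v *)
Require Import Defs.
From mathcomp Require Import all_boot all_order all_algebra.
From mathcomp Require Import all_classical all_reals all_analysis.
From mathcomp Require Import complex zify ring lra.

(** For n = 2m the spectrum of the cycle is 2 cos (pi j / m), j < 2m, odd under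
    j -> j + m, so U(t)_{u,u} is the real function
    f t = (1/m) sum_(j < m) cos (2 t cos (pi j / m)).
    If |f| were bounded below by d > 0 on t > 0, the intermediate value theorem
    and f 0 = 1 would give f >= d.  Sample f at t_k = (k + 1/2) pi and sum over
    k < N: up to the factor 1/m, the term j = 0 contributes -N, the term
    2j = m (if m is even) contributes N, and every other term is a sum
    sum_k cos ((2k+1) x) with sin x != 0, which is bounded in N.  Hence
    sum_(k < N) f (t_k) is bounded above, contradicting N d <= sum. *)

Import Order.TTheory GRing.Theory Num.Theory numFieldNormedType.Exports.
Local Open Scope ring_scope.
Local Open Scope complex_scope.
Local Open Scope classical_set_scope.

Lemma cvg_fin_sum (K : numFieldType) (V : normedModType K) (I : finType)
    (T : Type) (F : set_system T) (f : I -> T -> V) (l : I -> V) :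
  Filter F -> (forall i, f i @ F --> l i) ->
  (fun x => \sum_i f i x) @ F --> \sum_i l i.
Proof. by move=> FF fl; apply: cvg_big => // x; exact: add_continuous. Qed.

(** * Spectral form of the transition matrix *)

Section ComplexExponential.
Variable R : realType.
Implicit Types x y : R.
Local Notation C := (R[i] : numFieldType).

Definition expi x : R[i] := cos x +i* sin x.

Lemma expiD x y : expi (x + y) = expi x * expi y.
Proof.
rewrite /expi cosD sinD; apply/eqP; rewrite eq_complex /=.
by apply/andP; split; apply/eqP; ring.
Qed.

Lemma expi0 : expi 0 = 1.
Proof. by rewrite /expi cos0 sin0. Qed.

Lemma expiMn x k : expi (x *+ k) = expi x ^+ k.
Proof. by elim: k => [|k IH]; rewrite ?expi0 // mulrS expiD IH exprS. Qed.

Lemma cvg_real_complex (u : nat -> R) (l : R) :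
  u @ \oo --> l -> (fun k => (u k)%:C : C) @ \oo --> (l%:C : C).
Proof.
move=> /cvgrPdist_lt ul; apply/cvgrPdist_lt => -[e e'] /=.
(* A positive element of [R[i]] has zero imaginary part, so the radius is real. *)
rewrite ltcE /= => /andP[/eqP -> e0].
near=> k; rewrite -rmorphB /= normc_def /= expr0n /= addr0 sqrtr_sqr ltcR.
by near: k; apply: ul.
Unshelve. all: by end_near. Qed.

Lemma expi_coeffE x k :
  (x%:C * 'i) ^+ k / (k`!)%:R =
  (cos_coeff x k)%:C + (sin_coeff x k)%:C * 'i :> R[i].
Proof.
rewrite /cos_coeff /sin_coeff /= !rmorphM /= !fmorphV /= !rmorph_nat.
rewrite -exprnP !rmorphXn /= rmorphN rmorph1 exprMn.
(* Powers of ['i] are split by the parity of [k]; the exponent [k.-1./2] for odd [k] is the one in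
   [sin_coeff]. *)
have -> : 'i ^+ k =
  (~~ odd k)%:R * (-1) ^+ k./2 + (odd k)%:R * (-1) ^+ k.-1./2 * 'i :> R[i].
  rewrite -{1}[k]odd_double_half exprD -muln2 mulnC exprM sqrCi.
  case ok: (odd k); last by rewrite expr0 /= !mul0r addr0.
  rewrite -[k in k.-1]odd_double_half ok /= doubleK mul0r add0r mul1r.
  by rewrite expr1 mulrC.
ring.
Qed.

Lemma cvg_series_expi_coeff x :
  (series (fun k => (x%:C * 'i) ^+ k / (k`!)%:R : C) : nat -> C) @ \oo
    --> (expi x : C).
Proof.
have -> : series (fun k => (x%:C * 'i) ^+ k / (k`!)%:R : C) = fun N =>
    (series (cos_coeff x) N)%:C + (series (sin_coeff x) N)%:C * 'i :> C.
  apply/funext => N; rewrite /series /= !rmorph_sum mulr_suml -big_split /=.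
  by apply: eq_bigr => k _; exact: expi_coeffE.
have -> : expi x = (cos x)%:C + (sin x)%:C * 'i :> C.
  by rewrite [LHS]complexE complexiE mulrC.
apply: cvgD; first apply: cvg_real_complex.
  by rewrite unlock; exact: is_cvg_series_cos_coeff.
apply: cvgMl; apply: cvg_real_complex.
by rewrite unlock; exact: is_cvg_series_sin_coeff.
Qed.

(** Applying [A] repeatedly to the decomposition of [1%:M] gives A^k = sum of lam_i^k E_i, so the
    matrix series splits into finitely many scalar exponential series. *)
Lemma transU_spectral (n : nat) (A : 'M[R[i]]_n) (I : finType)
    (E : I -> 'M[R[i]]_n) (lam : I -> R) (t : R) :
  \sum_i E i = 1%:M -> (forall i, A *m E i = (lam i)%:C *: E i) ->
  transU A t = \sum_i expi (t * lam i) *: E i.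
Proof.
move=> E1 AE.
have powE k : mxpow A k = \sum_i (lam i)%:C ^+ k *: E i.
  rewrite /mxpow; elim: k => [|k IH].
    by rewrite -E1; apply: eq_bigr => i _; rewrite scale1r.
  rewrite iterS IH mulmx_sumr; apply: eq_bigr => i _.
  by rewrite -scalemxAr AE scalerA -exprSr.
apply: (@cvg_lim ('M[R[i]]_n : normedModType R[i]) (@norm_hausdorff _ _)
  _ _ _ (series _)).
rewrite (_ : series _ = fun N => \sum_i
  (series (fun k => ((t * lam i)%:C * 'i) ^+ k / (k`!)%:R) N : C) *: E i);
  last first.
  apply/funext => N; rewrite /series /=.
  under [RHS]eq_bigr do rewrite scaler_suml.
  rewrite exchange_big /=; apply: eq_bigr => k _.
  rewrite powE scaler_sumr; apply: eq_bigr => i _.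
  rewrite scalerA; congr (_ *: _).
  by rewrite rmorphM /= !exprMn; ring.
apply: (@cvg_fin_sum _ ('M[R[i]]_n : normedModType R[i])) => i.
by apply: cvgZr_tmp; exact: cvg_series_expi_coeff.
Qed.

(** * Fourier diagonalisation of the cycle *)

Lemma expi_neq1 x : 0 < x < pi *+ 2 -> expi x != 1.
Proof.
move=> /andP[x0 x2]; apply/eqP => /(congr1 (@complex.Re R)) /=.
(* By the double angle formula, cos x = 1 would force sin (x/2) = 0. *)
rewrite -[x](@divfK _ 2)// mulr_natr cos_mulr2n => h.
have : 0 < sin (x / 2) by apply: sin_gt0_pi; move: x2; rewrite -mulr_natr; lra.
have := cos2Dsin2 (x / 2); rewrite -mulr_natr in h; nra.
Qed.

Lemma expiN x : expi (- x) = (expi x)^-1.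
Proof. by apply/esym/mulr1_eq; rewrite -expiD subrr expi0. Qed.

Lemma expi_neq0 x : expi x != 0.
Proof.
have : expi x * expi (- x) != 0 by rewrite -expiD subrr expi0 oner_neq0.
by rewrite mulf_eq0 negb_or => /andP[].
Qed.

Lemma expiDN x : expi x + (expi x)^-1 = (2 * cos x)%:C.
Proof.
by rewrite -expiN /expi cosN sinN; apply/eqP; rewrite eq_complex /=;
   apply/andP; split; apply/eqP; ring.
Qed.

(** The neighbours of [a] are a + 1 and a - 1 modulo [n], and the powers of a root of unity respect
    the wrap-around. *)
Lemma cycle_adj_mul (n : nat) (z : R[i]) (a : 'I_n) : (2 < n)%N -> z ^+ n = 1 ->
  \sum_c cycle_adj R n a c * z ^+ c = (z + z^-1) * z ^+ a.
Proof.
move=> n2 zn.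
have z0 : z != 0.
  by apply: contra_eq_neq zn => ->;
  rewrite expr0n gtn_eqF ?(ltn_trans _ n2) // eq_sym oner_neq0.
have modz k : z ^+ (k %% n) = z ^+ k by exact: expr_mod.
(* The disjunction becomes a sum because the two neighbours differ when n > 2. *)
have adjE (c : 'I_n) :
    cycle_adj R n a c = (c == ordS a)%:R + (c == ord_pred a)%:R.
  have -> : (c == ord_pred a) = (ordS c == a).
    by apply/eqP/eqP => [->|<-]; rewrite ?ord_predK ?ordSK.
  have eqn (x y : 'I_n) : (x == y) = (x == y :> nat) by [].
  rewrite mxE eq_sym !eqn /=.
  case: eqP => [ca|_] /=; last by rewrite add0r.
  suff -> : (c.+1 %% n == a)%N = false by rewrite addr0.
  apply/negbTE; rewrite ca; case: (ltngtP a.+1 n) (ltn_ord a) => [h|//|h] _.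
    rewrite (modn_small h).
    have [h2|h2] := ltnP a.+2 n; first by rewrite modn_small //; lia.
    by rewrite (_ : a.+2 = n) ?modnn; lia.
  by rewrite h modnn modn_small //; lia.
under eq_bigr do rewrite adjE mulrDl.
have sum1 (d : 'I_n) : \sum_(c < n) (c == d)%:R * z ^+ c = z ^+ d.
  rewrite (bigD1 d) //= eqxx mul1r big1 ?addr0 // => c /negbTE ->.
  by rewrite mul0r.
rewrite big_split /= !sum1 mulrDl; congr (_ + _).
  by rewrite /= modz exprS.
have -> : z ^+ a = z * z ^+ ord_pred a.
  by rewrite -[in LHS](ord_predK a) /= modz exprS.
by rewrite mulKf.
Qed.

Lemma cycle_transU_diag (n : nat) (u : 'I_n) (t : R) : (2 < n)%N ->
  transU (cycle_adj R n) t u u =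
  n%:R^-1 * \sum_(j < n) expi (t * (2 * cos (pi *+ 2 / n%:R *+ j))).
Proof.
move=> n2; have n0 : n%:R != 0 :> R by rewrite pnatr_eq0; lia.
have n0C : n%:R != 0 :> R[i] by rewrite pnatr_eq0; lia.
set th := pi *+ 2 / n%:R; pose z j := expi (th *+ j).
have zn j : z j ^+ n = 1.
  rewrite /z -expiMn mulrnAC -[_ *+ n]mulr_natr divfK // expiMn.
  by rewrite /expi cos2pi sin2pi expr1n.
(* [E j] is the orthogonal projector onto the j-th Fourier vector: conjugation inverts [z j]. Its
   diagonal entries are all 1/n. *)
pose E (j : 'I_n) : 'M[R[i]]_n :=
  \matrix_(a, b) (n%:R^-1 * (z j ^+ a / z j ^+ b)).
rewrite (@transU_spectral _ _ _ E (fun j => 2 * cos (th *+ j))).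
- rewrite summxE mulr_sumr; apply: eq_bigr => j _.
  by rewrite !mxE divff ?expf_neq0 ?expi_neq0 // mulr1 [LHS]mulrC.
- apply/matrixP => a b; rewrite summxE mxE.
  (* Since z_j^a = z_a^j, summing over [j] gives a geometric sum whose ratio is an n-th root of
     unity; it vanishes unless that ratio is 1. *)
  have EE (j : 'I_n) : E j a b = n%:R^-1 * (z a / z b) ^+ j.
    by rewrite mxE exprMn exprVn /z -!expiMn -!mulrnA ![(j * _)%N]mulnC.
  under eq_bigr do rewrite EE.
  rewrite -mulr_sumr.
  have [->|ab] := eqVneq a b.
    under eq_bigr do rewrite divff ?expi_neq0 // expr1n.
    by rewrite sumr_const card_ord mulVf.
  have : (z a / z b - 1) * \sum_(j < n) (z a / z b) ^+ j == 0.
    by rewrite -subrX1 exprMn exprVn !zn divr1 subrr.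
  rewrite mulf_eq0 subr_eq0 => /orP[ab1|/eqP ->]; last by rewrite mulr0.
  have {ab1} zab : z a = z b.
    by rewrite -[LHS](divfK (expi_neq0 (th *+ b))) (eqP ab1) mul1r.
  have lt_neq (c d : 'I_n) : (c < d)%N -> z c != z d.
    move=> cd; apply: contraTneq isT => e.
    have : expi (th *+ (d - c)) != 1.
      have th_gt0 : 0 < th.
        apply: divr_gt0; last by rewrite ltr0n; lia.
        by rewrite mulr2n addr_gt0 // pi_gt0.
      have thn : th *+ n = pi *+ 2 by rewrite -[LHS]mulr_natr divfK.
      apply: expi_neq1; apply/andP; split.
        by rewrite pmulrn_lgt0 // subn_gt0.
      rewrite -thn (ltr_pMn2l th_gt0).
      by have := ltn_ord d; lia.
    by rewrite mulrnBr ?(ltnW cd) // expiD expiN -/(z d) -/(z c) e divff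
      ?eqxx // expi_neq0.
  by case: (ltngtP a b) => [/lt_neq|/lt_neq|/val_inj];
    rewrite ?zab ?eqxx //; move/eqP: ab.
- move=> j; apply/matrixP => a b; rewrite [LHS]mxE -expiDN -/(z j).
  have AE (c : 'I_n) : cycle_adj R n a c * E j c b =
      n%:R^-1 / z j ^+ b * (cycle_adj R n a c * z j ^+ c).
    by rewrite [E j c b]mxE; ring.
  under eq_bigr do rewrite AE.
  by rewrite -mulr_sumr cycle_adj_mul // !mxE; ring.
Qed.

Lemma cycle_transU_even (m : nat) (u : 'I_(m + m)) (t : R) : (1 < m)%N ->
  transU (cycle_adj R (m + m)) t u u =
  (m%:R^-1 * \sum_(j < m) cos (2 * t * cos (pi / m%:R *+ j)))%:C.
Proof.
move=> m1; have m0 : m%:R != 0 :> R by rewrite pnatr_eq0; lia.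
rewrite cycle_transU_diag; last by lia.
have thE : pi *+ 2 / (m + m)%:R = pi / m%:R :> R.
  by rewrite addnn -muln2 natrM -[pi *+ 2]mulr_natr -mulf_div divff ?mulr1 //
    pnatr_eq0.
rewrite thE big_split_ord /= -big_split /=.
(* Index m + j shifts the angle by pi and negates the eigenvalue, so the paired exponentials are
   inverse and add up to twice a cosine. *)
under eq_bigr => j _.
  have -> : pi / m%:R *+ (m + j) = pi / m%:R *+ j + pi :> R.
    by rewrite mulrnDr -[_ *+ m]mulr_natr divfK // addrC.
  rewrite cosDpi !mulrN expiN expiDN.
  over.
rewrite -rmorph_sum -mulr_sumr addnn -muln2 natrM.
rewrite rmorphM rmorph_nat [RHS]rmorphM /= fmorphV rmorph_nat.
under eq_bigr do rewrite mulrA [t * 2]mulrC.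
by rewrite invfM mulrA divfK // pnatr_eq0.
Qed.

End ComplexExponential.

(** * Sums over odd multiples *)

Section Averages.
Variable R : realType.
Implicit Types x t : R.

(** Telescoping: 2 sin x cos((2k+1)x) = sin((2k+2)x) - sin(2kx). *)
Lemma sum_cos_odd x (N : nat) :
  2 * sin x * \sum_(k < N) cos (k.*2.+1%:R * x) = sin (N.*2%:R * x).
Proof.
elim: N => [|N IH]; first by rewrite big_ord0 mul0r sin0 mulr0.
rewrite big_ord_recr /= mulrDr IH.
have -> : N.*2%:R * x = N.*2.+1%:R * x - x.
  by rewrite -[N.*2.+1]addn1 natrD; ring.
have -> : N.+1.*2%:R * x = N.*2.+1%:R * x + x.
  by rewrite doubleS -[N.*2.+2]addn1 natrD; ring.
rewrite sinB sinD; ring.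
Qed.

Lemma sum_cos_odd_le x (N : nat) : sin x != 0 ->
  \sum_(k < N) cos (k.*2.+1%:R * x) <= `|2 * sin x|^-1.
Proof.
move=> sx; have s2 : 2 * sin x != 0 by rewrite mulf_neq0.
rewrite (le_trans (ler_norm _)) // -[leRHS]mul1r ler_pdivlMr ?normr_gt0 //.
by rewrite -normrM mulrC sum_cos_odd sin_max.
Qed.

Lemma cos_odd_mul_pi (k : nat) : cos (k.*2.+1%:R * pi) = -1 :> R.
Proof.
elim: k => [|k IH]; first by rewrite double0 mul1r cospi.
have -> : k.+1.*2.+1%:R * pi = k.*2.+1%:R * pi + pi *+ 2 :> R.
  by rewrite doubleS -[k.*2.+3]addn2 natrD mulrDl [2 * _]mulr_natl.
by rewrite cosD2pi.
Qed.

(* The sine vanishes exactly for j = 0 and 2j = m; there 0^-1 = 0 and the term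
   in N is the whole sum. *)
Lemma sum_cos_odd_cycle_le (m N : nat) (j : 'I_m) :
  \sum_(k < N) cos (k.*2.+1%:R * (pi * cos (pi / m%:R *+ j))) <=
  `|2 * sin (pi * cos (pi / m%:R *+ j))|^-1 +
  N%:R * ((j.*2 == m)%:R - (j == 0 :> nat)%:R) :> R.
Proof.
have m0 : (0 < m)%N by have := ltn_ord j; lia.
have mR : (0 : R) < m%:R by rewrite ltr0n.
have [j0|j0] := eqVneq (j : nat) 0%N.
  rewrite j0 mulr0n cos0 mulr1; under eq_bigr do rewrite cos_odd_mul_pi.
  rewrite sumr_const card_ord double0 (ltn_eqF m0) sub0r mulrN mulr1 mulNrn.
  by rewrite lerDr invr_ge0.
set th := pi / m%:R *+ j.
have thE : th = pi * (j%:R / m%:R) by rewrite /th -mulr_natr; ring.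
have jR : (0 : R) < j%:R by rewrite ltr0n lt0n.
have jm : j%:R / m%:R < 1 :> R by rewrite ltr_pdivrMr // mul1r ltr_nat.
have th0 : 0 < th by rewrite thE mulr_gt0 ?pi_gt0 // divr_gt0.
have thpi : th < pi by rewrite thE -[ltRHS]mulr1 ltr_pM2l ?pi_gt0.
have [j2|j2] := eqVneq j.*2 m.
  have -> : th = pi / 2.
    have -> : pi / 2 = pi * (j%:R / j.*2%:R) :> R; last by rewrite thE j2.
    by rewrite -muln2 natrM invfM [j%:R * (_ * _)]mulrA divff ?mul1r //
      lt0r_neq0.
  rewrite cos_pihalf mulr0; under eq_bigr do rewrite mulr0 cos0.
  by rewrite sumr_const card_ord subr0 mulr1 lerDr invr_ge0.
rewrite subrr mulr0 addr0; apply: sum_cos_odd_le.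
have sin2 : sin th ^+ 2 > 0 by rewrite exprn_gt0 // sin_gt0_pi // th0.
have cs := cos2Dsin2 th.
have pi0 : 0 < pi :> R by exact: pi_gt0.
(* Once [cos th] is also known to be nonzero, [pi * cos th] lies strictly between 0 and pi or
   between -pi and 0, where sine has no zero. *)
have [cl c1] : -1 < cos th /\ cos th < 1 by split; nra.
have [jlt|jgt] := ltnP j.*2 m.
- have c0 : 0 < cos th.
    apply: cos_gt0_pihalf; apply/andP; split; first lra.
    rewrite thE ltr_pM2l // ltr_pdivrMr // mulrC ltr_pdivlMr // -natrM ltr_nat.
    lia.
  by rewrite gt_eqF // sin_gt0_pi //; apply/andP; split; nra.
- have c0 : cos th < 0.
    suff : 0 < cos (pi - th) by rewrite addrC cosDpi cosN oppr_gt0.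
    have thpi2 : pi / 2 < th.
      rewrite thE ltr_pM2l // ltr_pdivlMr // mulrC ltr_pdivrMr // -natrM.
      rewrite ltr_nat; lia.
    by apply: cos_gt0_pihalf; apply/andP; split; lra.
  rewrite -oppr_eq0 -sinN -mulrN.
  by rewrite gt_eqF // sin_gt0_pi //; apply/andP; split; nra.
Qed.

Lemma sum_cos_cycle_bounded (m : nat) : (1 < m)%N ->
  exists B : R, forall N : nat,
    \sum_(k < N) \sum_(j < m)
      cos (k.*2.+1%:R * (pi * cos (pi / m%:R *+ j))) <= B.
Proof.
move=> m1; exists (\sum_(j < m) `|2 * sin (pi * cos (pi / m%:R *+ j))|^-1) => N.
rewrite exchange_big /=.
apply: le_trans; first by apply: ler_sum => j _; exact: sum_cos_odd_cycle_le.
(* The terms linear in [N] total at most 0: exactly one index has j = 0, and at most one, [m./2],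
   has 2j = m. *)
rewrite big_split /= gerDl -mulr_sumr mulr_ge0_le0 ?ler0n // sumrB subr_le0.
have mhalf : (m./2 < m)%N by lia.
have sum1 (d : 'I_m) : \sum_(j < m) (j == d)%:R = 1 :> R.
  by rewrite (bigD1 d) //= eqxx big1 ?addr0 // => j /negbTE ->.
have -> : \sum_(j < m) (j == 0 :> nat)%:R = 1 :> R.
  exact: (sum1 (Ordinal (ltnW m1))).
rewrite -[leRHS](sum1 (Ordinal mhalf)); apply: ler_sum => j _; rewrite ler_nat.
case: eqP => //= jm; suff -> : j = Ordinal mhalf by rewrite eqxx.
by apply: val_inj; rewrite /= -{2}jm doubleK.
Qed.

End Averages.

(** * From bounded sample sums to a zero infimum *)

Lemma not_sedentary_of_real (R : realType) (n : nat) (A : 'M[R[i]]_n) (u : 'I_n)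
    (f : R -> R) (t_ : nat -> R) (B : R) :
  (forall t, transU A t u u = (f t)%:C) -> continuous f -> 0 < f 0 ->
  (forall k, 0 < t_ k) -> (forall N, \sum_(k < N) f (t_ k) <= B) ->
  not_sedentary A u.
Proof.
move=> Uf fc f0 t_gt0 sumB; rewrite /not_sedentary.
set S := [set _ | t in _].
have SE : S = [set `|f t| | t in [set t : R | 0 < t]].
  apply/seteqP; split => _ [t t0 <-]; exists t => //;
  by rewrite Uf /= expr0n /= addr0 sqrtr_sqr.
have S0 : lbound S 0 by rewrite SE => _ [t _ <-].
have Sne : S !=set0.
  by rewrite SE; exists `|f (t_ 0%N)|; exists (t_ 0%N) => //; exact: t_gt0.
apply/eqP; rewrite eq_le lb_le_inf // andbT leNgt; apply/negP => d0.
set d := inf S in d0.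
have fd t : 0 < t -> d <= `|f t|.
  by move=> t0; apply: ge_inf; [exists 0 | rewrite SE; exists t].
have fpos k : d <= f (t_ k).
  rewrite -[leRHS]ger0_norm ?fd // leNgt; apply/negP => fk0.
  have [] := @IVT R f 0 (t_ k) 0 (ltW (t_gt0 k)).
  - exact: continuous_subspaceT.
  - by rewrite ge_min le_max (ltW fk0) (ltW f0) orbT.
  move=> c; rewrite in_itv /= => /andP[c0 _] fc0.
  (* The zero [c] is not the left endpoint because f 0 > 0, so the lower bound [d] applies at
     [c]. *)
  have c_gt0 : 0 < c.
    by rewrite lt_neqAle c0 andbT; apply: contraTneq f0 => e;
      rewrite [in f 0]e fc0 ltxx.
  by have := fd _ c_gt0; rewrite fc0 normr0 leNgt d0.
have NdB N : N%:R * d <= B.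
  apply: le_trans (sumB N).
  rewrite mulr_natl -[X in _ *+ X](card_ord N) -sumr_const.
  by apply: ler_sum => k _; exact: fpos.
(* Archimedean choice of [N] exceeding B/d. *)
have := NdB (Num.truncn (B / d)).+1; rewrite -ler_pdivlMr // leNgt.
by rewrite truncnS_gt.
Qed.

Theorem theorem44 (R : realType) (n : nat) :
  (4 <= n)%N -> ~~ odd n ->
  forall u : 'I_n, not_sedentary (cycle_adj R n) u.
Proof.
move=> n4 n_even.
have [m m1 ->] : exists2 m, (1 < m)%N & n = (m + m)%N by exists n./2; lia.
move=> u; have mR : (0 : R) < m%:R by rewrite ltr0n; lia.
pose f (t : R) := m%:R^-1 * \sum_(j < m) cos (2 * t * cos (pi / m%:R *+ j)).
have [B hB] := @sum_cos_cycle_bounded R m m1.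
(* These times make 2t an odd multiple of pi, matching the sums bounded by [B]. *)
apply: (@not_sedentary_of_real R _ _ u f (fun k => k.*2.+1%:R * pi / 2)
  (m%:R^-1 * B)).
- by move=> t; rewrite cycle_transU_even.
- move=> t; apply: cvgM; first exact: cvg_cst.
  apply: cvg_fin_sum => j.
  apply: continuous_comp; last exact: continuous_cos.
  by apply: cvgMl; apply: cvgM; [exact: cvg_cst | exact: cvg_id].
- rewrite /f; under eq_bigr do rewrite mulr0 mul0r cos0.
  by rewrite sumr_const card_ord mulVf ?gt_eqF.
- by move=> k; rewrite divr_gt0 // mulr_gt0 ?pi_gt0.
- move=> N; rewrite /f -mulr_sumr ler_pM2l ?invr_gt0 //.
  apply: le_trans (hB N); apply: ler_sum => k _; apply: ler_sum => j _.
  suff -> : 2 * (k.*2.+1%:R * pi / 2) = k.*2.+1%:R * pi :> R by rewrite mulrA.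
  by rewrite mulrC divfK.
Qed.
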